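(* Let $G$ be a finite simple connected graph with at least two vertices and diameter $d$. If for each vertex $x$ of $G$ there is exactly one vertex of $G$ at distance $d$ from $x$, then $G$ is $\{1,2,\ldots,d-1\}$-distance magic.
   Context: Let $G=(V,E)$ be a finite simple undirected graph with $v=|V|$ vertices, and let $d(x,y)$ be the graph distance. For a set $D$ of nonnegative integers and $x\in V$, put $N_D(x)=\{y\in V : d(x,y)\in D\}$. A $D$-distance magic labeling of $G$ is a bijection $f:V\to\{1,2,\ldots,v\}$ for which there is a constant $\mathsf{k}$ such that $\sum_{y\in N_D(x)} f(y)=\mathsf{k}$ for every $x\in V$ (an empty sum is $0$). $G$ is called $D$-distance magic if it admits a $D$-distance magic labeling. *)

(* Defs.v *)
From mathcomp Require Export all_boot.

Set Implicit Arguments.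
Unset Strict Implicit.
Unset Printing Implicit Defensive.

(* A finite simple graph is given by its adjacency relation [e : rel V] on a
   finite type [V], with [symmetric e] and [irreflexive e]. *)

Definition connected (V : finType) (e : rel V) : Prop :=
  forall x y, connect e x y.

(* [n] counts edges, so the walk visits n.+1 vertices. *)
Definition walk (V : finType) (e : rel V) (n : nat) (x y : V) : bool :=
  [exists p : n.-tuple V, path e x p && (last x p == y)].

Lemma walkP (V : finType) (e : rel V) n x y :
  reflect (exists p : seq V, [/\ size p = n, path e x p & last x p = y])
          (walk e n x y).
Proof.
apply: (iffP existsP) => [[p /andP[xp /eqP lp]]|[p [sp xp lp]]].
  by exists p; split=> //; rewrite size_tuple.
have szp : size p == n by apply/eqP.
by exists (Tuple szp); rewrite /= xp lp eqxx.
Qed.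

Lemma connect_walk (V : finType) (e : rel V) x y :
  connect e x y -> exists n, walk e n x y.
Proof.
by case/connectP=> p xp ->; exists (size p); apply/walkP; exists p.
Qed.

(* [None] is the infinite distance between different components. *)
Definition gdist (V : finType) (e : rel V) (x y : V) : option nat :=
  match @idP (connect e x y) with
  | ReflectT xy => Some (ex_minn (connect_walk xy))
  | ReflectF _ => None
  end.

Lemma gdist_SomeP (V : finType) (e : rel V) x y n :
  gdist e x y = Some n <->
  walk e n x y /\ (forall m, walk e m x y -> n <= m).
Proof.
rewrite /gdist; case: {-}_ / idP => [xy|nxy].
  case: ex_minnP => m wm minm; split=> [[<-]|[wn minn]] //.
  by congr Some; apply/eqP; rewrite eqn_leq minm // minn.
split=> // -[/walkP[p [_ xp lp]] _]; case: nxy.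
by apply/connectP; exists p.
Qed.

(* Intended for connected graphs only: infinite distances are ignored. *)
Definition diameter (V : finType) (e : rel V) : nat :=
  \max_(x : V) \max_(y : V) odflt 0 (gdist e x y).

(* N_D(x); an infinite distance belongs to no D. *)
Definition dnbhd (V : finType) (e : rel V) (D : pred nat) (x : V) : {set V} :=
  [set y | if gdist e x y is Some n then D n else false].

Definition bijective_labeling (V : finType) (f : V -> nat) : Prop :=
  injective f /\ (forall k, (exists x, f x = k) <-> 1 <= k <= #|V|).

Definition distance_magic_labeling (V : finType) (e : rel V) (D : pred nat)
    (f : V -> nat) : Prop :=
  bijective_labeling f /\
  exists k : nat, forall x : V, \sum_(y in dnbhd e D x) f y = k.

Definition distance_magic (V : finType) (e : rel V) (D : pred nat) : Prop :=
  exists f : V -> nat, distance_magic_labeling e D f.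

(* Main.v *)
Require Import Defs.
From mathcomp Require Import all_boot.

(** Sending each vertex [x] to the unique vertex [a x] at distance [d] from it
    defines an involution [a], because the distance is symmetric, and [a] has no
    fixed point, because [d > 0] when there are two vertices or more.  Since all
    distances are at most [d], the vertices at distance 1, ..., d - 1 from [x]
    are exactly those other than [x] and [a x].  It is therefore enough that
    [f x + f (a x)] does not depend on [x], for then every neighbourhood sum is
    the sum of all labels minus this constant.  The orbits of [a] are pairs, and
    labelling the [i]-th pair with [i] and [v + 1 - i] makes the constant equal
    to [v + 1] ([complementary_labeling]). *)

(** Decreasing the labels by 1 gives an injection from [V] to a set with [|V|]
    elements, which is onto by counting. *)
Lemma injective_bounded_labeling (V : finType) (f : V -> nat) :
  injective f -> (forall x, 1 <= f x <= #|V|) -> bijective_labeling f.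
Proof.
move=> f_inj f_range; split=> // k; split=> [[x <-] //|/andP[k_gt0 k_le]].
have f_lt x : (f x).-1 < #|V|.
  by case/andP: (f_range x) => fx_gt0; rewrite prednK.
pose g x := Ordinal (f_lt x).
have g_inj : injective g.
  move=> x y /(congr1 (@nat_of_ord _)) /= fxy; apply: f_inj.
  case/andP: (f_range x) => fx_gt0 _; case/andP: (f_range y) => fy_gt0 _.
  by rewrite -(prednK fx_gt0) fxy prednK.
have k_lt : k.-1 < #|V| by rewrite prednK.
have [h _ gK] := inj_card_bij g_inj (eq_leq (card_ord #|V|)).
exists (h (Ordinal k_lt)).
have /(congr1 (@nat_of_ord _)) /= := gK (Ordinal k_lt).
set x := h _ => fx; case/andP: (f_range x) => fx_gt0 _.
by rewrite -(prednK fx_gt0) fx prednK.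
Qed.

(** The set [R] selects from every orbit [{x, a x}] the element of smaller rank.
    Then [V] is the disjoint union of [R] and its image under [a], so the labels
    given to [R] are 1, ..., |V|/2 and their complements are the remaining
    ones. *)
Lemma complementary_labeling {V : finType} {a : V -> V} :
  involutive a -> (forall x, a x != x) ->
  exists2 f : V -> nat,
    bijective_labeling f & forall x, f x + f (a x) = #|V|.+1.
Proof.
move=> aK a_free.
pose R := [set x | enum_rank x < enum_rank (a x)].
have Ra x : (a x \in R) = (x \notin R).
  rewrite !inE aK -leqNgt ltn_neqAle.
  by rewrite (inj_eq (@ord_inj _)) (inj_eq enum_rank_inj) a_free.
have R_half : #|R| + #|R| = #|V|.
  rewrite -(cardsC R); congr (_ + _).
  rewrite -(card_imset (mem R) (inv_inj aK)); apply: eq_card => x.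
  by rewrite -{1}[x]aK mem_imset ?Ra ?inE //; apply: inv_inj.
pose idx x := index x (enum R).
have idx_lt x : x \in R -> idx x < #|R|.
  by move=> xR; rewrite cardE index_mem mem_enum.
have idx_inj x y : x \in R -> y \in R -> idx x = idx y -> x = y.
  by move=> xR yR; apply: (index_inj x); rewrite mem_enum.
pose f x := if x \in R then (idx x).+1 else #|V| - idx (a x).
have V_lt x : x \in R -> idx x < #|V|.
  by move=> xR; rewrite -R_half ltn_addr ?idx_lt.
have f_low x : x \in R -> f x <= #|R|.
  by move=> xR; rewrite /f xR idx_lt.
have f_high x : x \notin R -> #|R| < f x.
  move=> xR; rewrite /f (negPf xR) ltn_subRL -R_half ltn_add2r.
  by rewrite idx_lt ?Ra.
have f_sum x : f x + f (a x) = #|V|.+1.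
  rewrite /f Ra; case: ifPn => xR /=.
    by rewrite aK addSn subnKC // ltnW ?V_lt.
  by rewrite addnS subnK // ltnW ?V_lt ?Ra.
have f_gt0 x : 0 < f x.
  have [xR|xR] := boolP (x \in R); first by rewrite /f xR.
  exact: leq_ltn_trans (f_high x xR).
exists f => //; apply: injective_bounded_labeling => [x y fxy|x]; last first.
  by rewrite f_gt0 -ltnS -(f_sum x) -[X in X < _]addn0 ltn_add2l f_gt0.
have fa_xy : f (a x) = f (a y).
  by apply/eqP; rewrite -(eqn_add2l (f x)) f_sum fxy f_sum.
have [xR|xR] := boolP (x \in R); have [yR|yR] := boolP (y \in R).
- by move: fxy; rewrite /f xR yR => -[/idx_inj]; apply.
- by have := f_high y yR; rewrite -fxy ltnNge f_low.
- by have := f_high x xR; rewrite fxy ltnNge f_low.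
- move: fa_xy; rewrite /f !Ra xR yR => -[] /idx_inj.
  by rewrite !Ra => /(_ xR yR) /(inv_inj aK).
Qed.

Lemma walk_sym (V : finType) (e : rel V) n x y :
  symmetric e -> walk e n x y -> walk e n y x.
Proof.
move=> e_sym /walkP[p [<- xp <-]]; apply/walkP; exists (rev (belast x p)).
split; first by rewrite size_rev size_belast.
  by rewrite rev_path; under eq_path do rewrite e_sym.
by case: p {xp} => //= z p; rewrite rev_cons last_rcons.
Qed.

Lemma gdist_sym (V : finType) (e : rel V) n x y :
  symmetric e -> gdist e x y = Some n -> gdist e y x = Some n.
Proof.
move=> e_sym /gdist_SomeP[wn minn]; apply/gdist_SomeP.
by split=> [|m wm]; [apply: walk_sym|apply/minn/walk_sym].
Qed.

Lemma gdist_refl {V : finType} (e : rel V) x : gdist e x x = Some 0.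
Proof. by apply/gdist_SomeP; split=> //; apply/walkP; exists [::]. Qed.

Lemma gdist0_eq {V : finType} {e : rel V} {x y} : gdist e x y = Some 0 -> x = y.
Proof. by case/gdist_SomeP => /walkP[[|z p] [//= _ _]]. Qed.

Lemma connected_gdist {V : finType} {e : rel V} x y :
  connected e -> exists2 n, gdist e x y = Some n & n <= diameter e.
Proof.
move=> e_conn; case dxy: (gdist e x y) => [n|]; last first.
  by move: dxy; rewrite /gdist; case: {-}_ / idP.
exists n => //; rewrite /diameter.
apply: leq_trans (leq_bigmax x); apply: leq_trans (leq_bigmax y).
by rewrite dxy.
Qed.

Lemma diameter_gt0 {V : finType} {e : rel V} :
  connected e -> 2 <= #|V| -> 0 < diameter e.
Proof.
move=> e_conn /card_gt1P[x [y [_ _ neq_xy]]].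
have [[|n] dxy n_le] := connected_gdist x y e_conn; last exact: leq_trans n_le.
by rewrite (gdist0_eq dxy) eqxx in neq_xy.
Qed.

Theorem lemma7 (V : finType) (e : rel V) (e_sym : symmetric e)
    (e_irr : irreflexive e) (e_conn : connected e) (V_ge2 : 2 <= #|V|)
    (antipode : forall x : V,
       exists! y : V, gdist e x y = Some (diameter e)) :
  distance_magic e (fun n : nat => 1 <= n <= diameter e - 1).
Proof.
have d_gt0 := diameter_gt0 e_conn V_ge2.
have [a a_spec] := fin_all_exists antipode.
have a_dist x : gdist e x (a x) = Some (diameter e) by case: (a_spec x).
have a_uniq x y : gdist e x y = Some (diameter e) -> a x = y.
  by case: (a_spec x) => _; apply.
have aK : involutive a by move=> x; apply/a_uniq/gdist_sym.
have a_free x : a x != x.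
  apply/eqP => ax; have := a_dist x; rewrite ax gdist_refl => -[d0].
  by rewrite -d0 in d_gt0.
have nbhdE x y : (y \in dnbhd e (fun n => 1 <= n <= diameter e - 1) x) =
    (y != x) && (y != a x).
  rewrite inE; have [n dxy n_le] := connected_gdist x y e_conn; rewrite dxy.
  have -> : (y != x) = (0 < n).
    rewrite lt0n; congr (~~ _); apply/eqP/eqP => [yx|n0].
      by move: dxy; rewrite yx gdist_refl => -[].
    by rewrite n0 in dxy; rewrite (gdist0_eq dxy).
  congr (_ && _).
  have -> : (y != a x) = (n != diameter e).
    congr (~~ _); apply/eqP/eqP => [yax|nd].
      by move: dxy; rewrite yax a_dist => -[].
    by apply/esym/a_uniq; rewrite dxy nd.
  by rewrite -ltnS subn1 prednK // ltn_neqAle n_le andbT.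
have [f f_bij f_sum] := complementary_labeling aK a_free.
exists f; split=> //; exists (\sum_y f y - #|V|.+1) => x.
have -> : \sum_y f y = #|V|.+1 + \sum_(y | (y != x) && (y != a x)) f y.
  by rewrite (bigD1 x) //= (bigD1 (a x)) //= addnA f_sum.
by rewrite addKn; apply: eq_bigl.
Qed.
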